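(* Consider a graph $G=(V=[n],E)$ and let $M\in\mathcal{C}(G)\cap\mathcal{S}^n_+$. The following assertions are equivalent: (i) $M$ satisfies the Strong Arnold Property. (ii) $M$ is a primal nondegenerate solution for the semidefinite program $$\sup_X\{\langle C,X\rangle:\ \langle E_{ij},X\rangle=0\ \text{for } \{i,j\}\in\overline{E},\ X\succeq 0\},$$ for any $C\in\mathcal{S}^n$. (iii) $M$ is a dual nondegenerate solution for the dual of the semidefinite program $$\sup_X\{0:\ \langle E_{ij},X\rangle=a_{ij}\ \text{for } \{i,j\}\in V\cup E,\ X\succeq 0\},$$ for any $a\in\mathcal{S}_+(G)$.
   Context: $\mathcal{S}^n$ is the space of real symmetric $n\times n$ matrices with trace inner product $\langle X,Y\rangle=\mathrm{Tr}(XY)$, and $\mathcal{S}^n_+$ is the cone of positive semidefinite (psd) matrices; $X\succeq0$ means $X$ is psd. $E_{ij}=(e_ie_j^{T}+e_je_i^{T})/2$, where $e_1,\dots,e_n$ are the standard unit vectors. $V=[n]$ is identified with the set of diagonal pairs $\{i,i\}$; $\overline{E}$ is the set of pairs $\{i,j\}$ with $i\neq j$, $\{i,j\}\notin E$. $\mathcal{C}(G)=\{X\in\mathcal{S}^n:\langle E_{ij},X\rangle=0\ \forall\{i,j\}\in\overline{E}\}$. $\mathcal{S}_+(G)$ is the set of $G$-partial psd matrices, i.e. vectors $a\in\mathbb{R}^{V\cup E}$ for which there is $X\in\mathcal{S}^n_+$ with $X_{ij}=a_{ij}$ for all $\{i,j\}\in V\cup E$. $\mathrm{lin}$ denotes linear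 span, and $\perp$ denotes orthogonal complement in $\mathcal{S}^n$. For $M\in\mathcal{S}^n$ of rank $r$ with spectral decomposition $M=Q\Lambda Q^{T}$ ($Q$ orthogonal, $\Lambda$ diagonal with $\Lambda_{ii}\neq0$ exactly for $i\in[r]$), set $$\mathcal{T}_M=\left\{Q\begin{pmatrix}U&W\\ W^{T}&0\end{pmatrix}Q^{T}:U\in\mathcal{S}^r,\ W\in\mathbb{R}^{r\times(n-r)}\right\}.$$ $M\in\mathcal{C}(G)$ satisfies the Strong Arnold Property if $\mathcal{T}_M+\mathrm{lin}\{E_{ij}:\{i,j\}\in V\cup E\}=\mathcal{S}^n$. For a semidefinite program $\sup_X\{\langle C,X\rangle: X\succeq0,\ \langle A_i,X\rangle=b_i\ (i\in I)\}$, the dual is $\inf_{y,Z}\{\sum_{i\in I}b_iy_i:\ \sum_{i\in I}y_iA_i-C=Z\succeq0\}$. A primal feasible $X$ is primal nondegenerate if $\mathcal{T}_X+\mathrm{lin}\{A_i:i\in I\}^{\perp}=\mathcal{S}^n$. A dual feasible $(y,Z)$ (or simply $Z$) is dual nondegenerate if $\mathcal{T}_Z+\mathrm{lin}\{A_i:i\in I\}=\mathcal{S}^n$. In (ii) and (iii), ''solution'' means feasible solution. *)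

(* Defs.v *)
From mathcomp Require Import all_boot all_order all_algebra.
From mathcomp Require Import all_classical all_reals.

Set Implicit Arguments.
Unset Strict Implicit.
Unset Printing Implicit Defensive.

Import Order.TTheory GRing.Theory Num.Theory.
Local Open Scope classical_set_scope.
Local Open Scope ring_scope.

Section Matrices.
Context {R : realType} {n : nat}.

Definition symmx : set 'M[R]_n := [set X | X^T = X].

Definition mxip (X Y : 'M[R]_n) : R := \tr (X *m Y).

Definition psdmx : set 'M[R]_n :=
  [set X | symmx X /\ forall u : 'cV[R]_n, 0 <= (u^T *m X *m u) 0 0].

Definition Emx (i j : 'I_n) : 'M[R]_n :=
  2^-1 *: (delta_mx i j + delta_mx j i).

Definition mxlin {I : finType} (A : I -> 'M[R]_n) : set 'M[R]_n :=
  [set X | X \in <<[seq A i | i : I]>>%VS].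

(* orthogonal complement inside the space of symmetric matrices *)
Definition mxperp (S : set 'M[R]_n) : set 'M[R]_n :=
  [set X | symmx X /\ forall Y, S Y -> mxip Y X = 0].

Definition mxsumset (S T : set 'M[R]_n) : set 'M[R]_n :=
  [set X + Y | X in S & Y in T].

(* The nonzero eigenvalues come first; 'I_n starts at 0, so these are the
   indices i < \rank M. *)
Definition spectral_decomp (M Q : 'M[R]_n) (d : 'rV[R]_n) : Prop :=
  [/\ Q *m Q^T = 1%:M,
      M = Q *m diag_mx d *m Q^T
    & forall i, (d 0 i != 0) = (i < \rank M)%N].

Lemma rank_split (M : 'M[R]_n) : (\rank M + (n - \rank M) = n)%N.
Proof. exact: subnKC (rank_leq_row M). Qed.

(* The space does not depend on the spectral decomposition of M, so Q and d
   can be quantified existentially. *)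
Definition tangent_space (M : 'M[R]_n) : set 'M[R]_n :=
  [set N | exists Q d, spectral_decomp M Q d /\
     exists (U : 'M[R]_(\rank M)) (W : 'M[R]_(\rank M, n - \rank M)),
       U^T = U /\
       N = Q *m castmx (rank_split M, rank_split M) (block_mx U W W^T 0)
             *m Q^T].

End Matrices.

(* The unordered pair {i, j} is represented by (i, j) with i <= j; the edges
   of the graph are given by a symmetric irreflexive relation e. *)
Section Graphs.
Context {n : nat} (e : rel 'I_n).

Definition is_VE (p : 'I_n * 'I_n) : bool :=
  (p.1 == p.2) || ((p.1 < p.2)%N && e p.1 p.2).

Definition is_nonedge (p : 'I_n * 'I_n) : bool :=
  (p.1 < p.2)%N && ~~ e p.1 p.2.

Definition VE : finType := {p : 'I_n * 'I_n | is_VE p}.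
Definition nonedge : finType := {p : 'I_n * 'I_n | is_nonedge p}.

Context {R : realType}.

Definition E_VE (p : VE) : 'M[R]_n := Emx (val p).1 (val p).2.
Definition E_nonedge (p : nonedge) : 'M[R]_n := Emx (val p).1 (val p).2.

Definition CG : set 'M[R]_n :=
  [set X | symmx X /\ forall p : nonedge, mxip (E_nonedge p) X = 0].

Definition partial_psd : set (VE -> R) :=
  [set a | exists X : 'M[R]_n,
     psdmx X /\ forall p : VE, X (val p).1 (val p).2 = a p].

Definition strong_arnold (M : 'M[R]_n) : Prop :=
  mxsumset (tangent_space M) (mxlin E_VE) = symmx.

End Graphs.

(* sup <C, X>  subject to  X psd and <A i, X> = b i for all i *)
Record sdp (R : realType) (n : nat) := SDP {
  sdp_idx : finType;
  sdp_C : 'M[R]_n;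
  sdp_A : sdp_idx -> 'M[R]_n;
  sdp_b : sdp_idx -> R
}.

Section SemidefinitePrograms.
Context {R : realType} {n : nat} (P : sdp R n).

Definition primal_objective (X : 'M[R]_n) : R := mxip (sdp_C P) X.

Definition primal_feasible (X : 'M[R]_n) : Prop :=
  psdmx X /\ forall i, mxip (sdp_A i) X = sdp_b (s := P) i.

Definition dual_objective (y : sdp_idx P -> R) : R :=
  \sum_i sdp_b i * y i.

Definition dual_feasible (y : sdp_idx P -> R) (Z : 'M[R]_n) : Prop :=
  \sum_i y i *: sdp_A i - sdp_C P = Z /\ psdmx Z.

Definition primal_nondegenerate (X : 'M[R]_n) : Prop :=
  primal_feasible X /\
  mxsumset (tangent_space X) (mxperp (mxlin (@sdp_A _ _ P))) = symmx.

Definition dual_nondegenerate (Z : 'M[R]_n) : Prop :=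
  (exists y, dual_feasible y Z) /\
  mxsumset (tangent_space Z) (mxlin (@sdp_A _ _ P)) = symmx.

End SemidefinitePrograms.

Section GraphPrograms.
Context {R : realType} {n : nat} (e : rel 'I_n).

Definition sdp_nonedge (C : 'M[R]_n) : sdp R n :=
  SDP C (@E_nonedge n e R) (fun=> 0).

Definition sdp_completion (a : VE e -> R) : sdp R n :=
  SDP 0 (@E_VE n e R) a.

End GraphPrograms.

(* Main.v *)
(** Both nondegeneracy conditions have the shape of the Strong Arnold Property,
    the span of the [E_ij] over [V ∪ E] being replaced in (ii) by the orthogonal
    complement of the span of the [E_ij] over the non-edges.  These two spaces
    are both equal to [C(G)]; so the three equations are literally the same, and
    only the feasibility of [M] is left, which follows from [M] being psd and
    in [C(G)]. *)
Require Import Defs.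
From mathcomp Require Import all_boot all_order all_algebra.
From mathcomp Require Import all_classical all_reals.

Set Implicit Arguments.
Unset Strict Implicit.
Unset Printing Implicit Defensive.

Import Order.TTheory GRing.Theory Num.Theory.
Local Open Scope classical_set_scope.
Local Open Scope ring_scope.

Lemma mem_mxlin (R : realType) (n : nat) (I : finType) (A : I -> 'M[R]_n)
    (i : I) :
  mxlin A (A i).
Proof. by apply/memv_span/map_f; rewrite mem_enum. Qed.

(** The span is a sum of lines, one per index, so a member splits into multiples of the [A i]. *)
Lemma mxlinP (R : realType) (n : nat) (I : finType) (A : I -> 'M[R]_n)
    (X : 'M[R]_n) :
  mxlin A X <-> exists y : I -> R, \sum_i y i *: A i = X.
Proof.
split=> [|[y <-]]; last first.
  by apply: memv_suml => i _; apply/memvZ/mem_mxlin.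
rewrite /mxlin /= span_def big_map big_enum => /memv_sumP[v vA ->].
have /choice[y yE] i : exists k, v i = k *: A i by apply/vlineP/vA.
by exists y; apply: eq_bigr => i _; rewrite yE.
Qed.

Lemma Emx_sym (R : realType) (n : nat) (i j : 'I_n) :
  Emx i j = Emx j i :> 'M[R]_n.
Proof. by rewrite /Emx addrC. Qed.

Lemma trmx_Emx (R : realType) (n : nat) (i j : 'I_n) :
  (Emx i j)^T = Emx i j :> 'M[R]_n.
Proof. by rewrite /Emx linearZ linearD /= !trmx_delta addrC. Qed.

Lemma mxip_delta (R : realType) (n : nat) (i j : 'I_n) (X : 'M[R]_n) :
  mxip (delta_mx i j) X = X j i.
Proof.
rewrite /mxip /mxtrace (bigD1 i) //= big1 ?addr0 => [|k ki]; last first.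
  by rewrite mxE big1 // => l _; rewrite mxE (negPf ki) mul0r.
rewrite mxE (bigD1 j) //= big1 ?addr0 ?mxE ?eqxx ?mul1r // => l lj.
by rewrite mxE (negPf lj) andbF mul0r.
Qed.

Lemma mxip_Emx (R : realType) (n : nat) (i j : 'I_n) (X : 'M[R]_n) :
  symmx X -> mxip (Emx i j) X = X i j.
Proof.
move=> X_sym; rewrite /mxip -scalemxAl mulmxDl mxtraceZ mxtraceD.
rewrite -/(mxip _ X) -/(mxip (delta_mx j i) X) !mxip_delta.
rewrite -[in X j i]X_sym mxE -mulr2n -(mulr_natl (X i j)) mulrA mulVf ?mul1r //.
by rewrite pnatr_eq0.
Qed.

(** Summing over ordered pairs spreads each entry evenly over its two transposed positions, so the
    sum is the average of [X] and [X^T]. *)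
Lemma symmx_sum_Emx (R : realType) (n : nat) (X : 'M[R]_n) :
  symmx X -> X = \sum_i \sum_j X i j *: Emx i j.
Proof.
move=> X_sym; rewrite [RHS](_ : _ = 2^-1 *: (X + X^T)).
  rewrite X_sym -mulr2n -scaler_nat scalerA mulVf ?scale1r //.
  by rewrite pnatr_eq0.
rewrite {2 3}[X]matrix_sum_delta linear_sum -big_split scaler_sumr /=.
apply: eq_bigr => i _; rewrite linear_sum -big_split scaler_sumr /=.
apply: eq_bigr => j _; rewrite [in RHS]linearZ /= trmx_delta -scalerDr.
by rewrite !scalerA mulrC.
Qed.

(** Both sides consist of the symmetric matrices whose entries vanish at the non-edges. *)
Lemma mxlin_E_VE (R : realType) (n : nat) (e : rel 'I_n) :
  symmetric e -> mxlin (@E_VE n e R) = CG e.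
Proof.
move=> e_sym; apply/seteqP; split=> X.
  move=> /mxlinP[y <-].
  have X_sym : symmx (\sum_i y i *: @E_VE n e R i).
    rewrite /symmx /= linear_sum; apply: eq_bigr => p _.
    by rewrite linearZ /= trmx_Emx.
  split=> // -[[i j] /= nij]; have /andP[/= ij eij] := nij.
  rewrite /E_nonedge mxip_Emx //= summxE.
  apply: big1 => -[[k l] /= kl] _; rewrite /E_VE /= !mxE.
  (* A non-edge differs from every pair in [VE e]: in the same order by [~~ e i j], in the reverse
     order by [i < j]. *)
  suff [-> ->] : (i == k) && (j == l) = false /\ (i == l) && (j == k) = false.
    by rewrite addr0 !mulr0.
  split; apply/negP => /andP[/eqP ? /eqP ?]; subst; move: kl.
    by rewrite /is_VE /= (negPf eij) andbF orbF -val_eqE ltn_eqF.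
  by rewrite /is_VE /= -val_eqE gtn_eqF //= ltnNge ltnW.
move=> [X_sym X_nonedge]; rewrite (symmx_sum_Emx X_sym).
have mem (i j : 'I_n) : is_VE e (i, j) -> Emx i j \in
    <<[seq @E_VE n e R p | p : VE e]>>%VS.
  by move=> ij; exact: (mem_mxlin (@E_VE n e R) (Sub (i, j) ij)).
have X0 (i j : 'I_n) : (i < j)%N -> ~~ e i j -> X i j = 0.
  move=> ij eij; have ne : is_nonedge e (i, j) by apply/andP.
  by have := X_nonedge (Sub (i, j) ne); rewrite mxip_Emx.
(* Each term is either a multiple of a generator, possibly after swapping [i] and [j], or zero
   because {i, j} is a non-edge. *)
apply: memv_suml => i _; apply: memv_suml => j _.
have [eij|eij] := boolP (e i j).
  apply: memvZ; have [ij|ji|/val_inj ->] := ltngtP i j.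
  - by apply: mem; rewrite /is_VE /= ij eij orbT.
  - by rewrite Emx_sym; apply: mem; rewrite /is_VE /= ji e_sym eij orbT.
  - by apply: mem; rewrite /is_VE /= eqxx.
have [ij|ji|/val_inj ->] := ltngtP i j.
- by rewrite X0 // scale0r mem0v.
- by rewrite -X_sym mxE X0 1?e_sym // scale0r mem0v.
- by apply/memvZ/mem; rewrite /is_VE /= eqxx.
Qed.

(** By linearity, orthogonality to a span reduces to orthogonality to its generators, which is how
    [CG e] is defined. *)
Lemma mxperp_E_nonedge (R : realType) (n : nat) (e : rel 'I_n) :
  mxperp (mxlin (@E_nonedge n e R)) = CG e.
Proof.
apply/seteqP; split=> X [X_sym X_perp]; split=> //.
  by move=> p; apply/X_perp/mem_mxlin.
move=> _ /mxlinP[y <-]; rewrite /mxip mulmx_suml linear_sum /= big1 // => p _.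
by rewrite -scalemxAl mxtraceZ -/(mxip _ X) X_perp mulr0.
Qed.

(** Provides an instance at which (iii) can be applied to recover (i). *)
Lemma partial_psd0 (R : realType) (n : nat) (e : rel 'I_n) :
  @partial_psd n e R (fun=> 0).
Proof.
exists 0; split=> [|p]; last by rewrite mxE.
by split=> [|u]; rewrite ?/symmx /= ?trmx0 // mulmx0 mul0mx mxE.
Qed.

Theorem theorem5p3 (R : realType) (n : nat) (e : rel 'I_n)
    (e_sym : symmetric e) (e_irr : irreflexive e)
    (M : 'M[R]_n) (M_CG : CG e M) (M_psd : psdmx M) :
  [<-> strong_arnold e M;
       forall C : 'M[R]_n, symmx C ->
         primal_nondegenerate (sdp_nonedge e C) M;
       forall a : VE e -> R, partial_psd a ->
         dual_nondegenerate (sdp_completion a) M].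
Proof.
have linE := mxlin_E_VE R e_sym; have perpE := mxperp_E_nonedge R e.
tfae=> [SAP C _|primal a _|dual].
- split; first by split=> //; case: M_CG.
  by rewrite [mxperp _]perpE -linE.
- split; last first.
    (* The nondegeneracy equation does not involve [C], so the choice [C = 0] suffices. *)
    have [|_] := primal 0; first by rewrite /symmx /= trmx0.
    by rewrite [mxperp _]perpE -linE.
  (* As the objective matrix is 0, the dual variables are the coefficients of [M] in the span. *)
  have /mxlinP[y yM] : mxlin (@E_VE n e R) M by rewrite linE.
  by exists y; split; rewrite //= subr0.
- by have [_] := dual _ (partial_psd0 R e).
Qed.
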